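(* Let $G=(V,E)$ be a graph and let $L(G)$ be its line graph. Then \[ \xi(G;1,x,x(y-1))=Q(L(G);x,y). \]
   Context: For a simple graph $H=(W,F)$, $Q(H;x,y)=\sum_{X\subseteq W}x^{|X|}y^{k(H[X])}$, where $H[X]$ is the induced subgraph and $k$ denotes the number of connected components (the null graph has $k=0$). The line graph $L(G)$ has the edges of $G$ as vertices, two being adjacent iff they share an endpoint. The universal edge elimination polynomial $\xi(G;x,y,z)$ is the graph polynomial determined by: $\xi(G;x,y,z)=\xi(G-e;x,y,z)+y\,\xi(G/e;x,y,z)+z\,\xi(G\dagger e;x,y,z)$ for every edge $e$; $\xi(G_1\sqcup G_2)=\xi(G_1)\xi(G_2)$ for disjoint unions; $\xi(E_1)=x$ for the one-vertex graph $E_1$ without edges; $\xi$ of the null graph is $1$. Here $G-e$ removes the edge $e$; $G/e$ identifies the endpoints of $e$; for $e=\{u,v\}$, $G\dagger e$ is the graph induced by $V\setminus\{u,v\}$. *)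

(* Defs.v *)
From HB Require Import structures.
From mathcomp Require Import all_boot all_order all_algebra.
From mathcomp Require Export mpoly.
From Stdlib Require Import ClassicalEpsilon.

Set Implicit Arguments.
Unset Strict Implicit.
Unset Printing Implicit Defensive.

Import GRing.Theory.
Local Open Scope ring_scope.

Record sgraph := SGraph {
  svert :> finType;
  sadj : rel svert;
  sadj_sym : ssrbool.symmetric sadj;
  sadj_irrefl : irreflexive sadj
}.

Section Induced.
Variables (H : sgraph) (X : {set H}).

Definition sinduced_adj : rel {w : H | w \in X} :=
  fun u v => sadj (val u) (val v).

Lemma sinduced_sym : ssrbool.symmetric sinduced_adj.
Proof. by move=> u v; exact: sadj_sym. Qed.

Lemma sinduced_irrefl : irreflexive sinduced_adj.
Proof. by move=> u; exact: sadj_irrefl. Qed.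

Definition sinduced : sgraph := SGraph sinduced_sym sinduced_irrefl.
End Induced.

Definition ncomp (H : sgraph) : nat := n_comp (@sadj H) H.

Definition Qpoly (H : sgraph) : {mpoly int[2]} :=
  \sum_(X : {set H}) 'X_0 ^+ #|X| * 'X_1 ^+ ncomp (sinduced X).

(* Graphs with parallel edges and loops allowed: contracting an edge of a
   simple graph may create both, and the recurrence for xi counts them.  An edge
   is sent to its set of endpoints, which is a singleton for a loop. *)

Record mgraph := MGraph {
  vert : finType;
  edge : finType;
  ends : edge -> {set vert};
  card_ends : forall e, (0 < #|ends e| <= 2)%N
}.

Definition miso (G H : mgraph) : Prop :=
  exists (phi : vert G -> vert H) (psi : edge G -> edge H),
    [/\ bijective phi, bijective psi
      & forall e, ends (psi e) = [set phi v | v in ends e]].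

Section LineGraph.
Variable G : mgraph.

Definition line_adj : rel (edge G) :=
  fun e f => (e != f) && ~~ [disjoint ends e & ends f].

Lemma line_adj_sym : ssrbool.symmetric line_adj.
Proof. by move=> e f; rewrite /line_adj eq_sym disjoint_sym. Qed.

Lemma line_adj_irrefl : irreflexive line_adj.
Proof. by move=> e; rewrite /line_adj eqxx. Qed.

Definition line_graph : sgraph := SGraph line_adj_sym line_adj_irrefl.
End LineGraph.

Section EdgeElimination.
Variable G : mgraph.

Section Delete.
Variable e : edge G.

Lemma card_ends_delete (f : {f : edge G | f != e}) :
  (0 < #|ends (val f)| <= 2)%N.
Proof. exact: card_ends. Qed.

Definition delete : mgraph := MGraph card_ends_delete.
End Delete.

Section Contract.
Variable e : edge G.

(* [None] is the vertex obtained by identifying the endpoints of [e]. *)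
Definition contract_vert : finType := option {v : vert G | v \notin ends e}.

Definition contract_map (v : vert G) : contract_vert := insub v.

Definition contract_ends (f : {f : edge G | f != e}) : {set contract_vert} :=
  [set contract_map v | v in ends (val f)].

Lemma card_ends_contract f : (0 < #|contract_ends f| <= 2)%N.
Proof.
have /andP[f_gt0 f_le2] := card_ends (val f).
rewrite (leq_trans (leq_imset_card _ _) f_le2) andbT card_gt0.
by rewrite imset_eq0 -card_gt0.
Qed.

Definition contract : mgraph := MGraph card_ends_contract.
End Contract.

Section MInduced.
Variable S : {set vert G}.

Definition minduced_ends (f : {f : edge G | ends f \subset S}) :
  {set {v : vert G | v \in S}} := [set v | val v \in ends (val f)].

Lemma card_ends_minduced f : (0 < #|minduced_ends f| <= 2)%N.
Proof.
have -> : #|minduced_ends f| = #|ends (val f)|.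
  rewrite -(card_imset (mem (minduced_ends f)) val_inj).
  apply: eq_card => v; apply/imsetP/idP => [[w + ->]|fv]; first by rewrite inE.
  by exists (Sub v (subsetP (valP f) v fv)); rewrite ?inE SubK.
exact: card_ends.
Qed.

Definition minduced : mgraph := MGraph card_ends_minduced.
End MInduced.

Definition extract (e : edge G) : mgraph := minduced (~: ends e).
End EdgeElimination.

Section DisjointUnion.
Variables G1 G2 : mgraph.

Definition munion_ends (e : edge G1 + edge G2) : {set vert G1 + vert G2} :=
  match e with
  | inl e1 => [set inl v | v in ends e1]
  | inr e2 => [set inr v | v in ends e2]
  end.

Lemma card_ends_munion e : (0 < #|munion_ends e| <= 2)%N.
Proof.
by case: e => e; rewrite card_imset ?card_ends // => u v [].
Qed.

Definition munion : mgraph := MGraph card_ends_munion.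
End DisjointUnion.

Section Edgeless.
Variable T : finType.

Lemma card_ends_edgeless (e : void) : (0 < #|of_void {set T} e| <= 2)%N.
Proof. by case: e. Qed.

Definition edgeless : mgraph := MGraph card_ends_edgeless.
End Edgeless.

Record is_xi (xi : mgraph -> {mpoly int[3]}) : Prop := IsXi {
  xi_iso : forall G H, miso G H -> xi G = xi H;
  xi_edge : forall G (e : edge G),
    xi G = xi (delete e) + 'X_1 * xi (contract e) + 'X_2 * xi (extract e);
  xi_union : forall G1 G2, xi (munion G1 G2) = xi G1 * xi G2;
  xi_vertex : xi (edgeless unit) = 'X_0;
  xi_null : xi (edgeless void) = 1
}.

(* The graph polynomial determined by [is_xi]; the default value given to
   [inhabits] would matter only if there were none. *)
Definition xi : mgraph -> {mpoly int[3]} := epsilon (inhabits (fun _ => 0)) is_xi.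

(* Main.v *)
(* For a set X of edges let i(X) be the number of vertices not covered by X and
   c(X) the number of components of L(G)[X].  The recurrence has the solution
     xi(G; x, y, z) = sum_X x^i(X) y^(|X| - c(X)) (x y + z)^c(X).
   Indeed the sets avoiding e give G - e.  If a set Y of other edges touches e,
   then Y + e and Y seen in G / e have the same i and c, so that the term of
   Y + e is y times that of Y in G / e.  If Y does not touch e, then e is a
   component of Y + e on its own; its factor x y + z gives the term of Y in G / e
   times y (the contracted vertex being uncovered) and the term of Y in G dagger e
   times z.  The solution is unique by induction on the number of edges.  At
   (1, x, x (y - 1)) the factor x y + z becomes x y, and the sum becomes
   Q(L(G); x, y) term by term. *)

Require Import Defs.
From mathcomp Require Import all_boot all_order all_algebra.
From Stdlib Require Import ClassicalEpsilon.
Import GRing.Theory.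
Local Open Scope ring_scope.

Set Implicit Arguments.
Unset Strict Implicit.
Unset Printing Implicit Defensive.

(** * Component counts of graphs and induced subgraphs *)

Lemma connect_homo (T T' : finType) (e : rel T) (e' : rel T') (f : T -> T') :
    (forall x y, e x y -> connect e' (f x) (f y)) ->
  forall x y, connect e x y -> connect e' (f x) (f y).
Proof.
move=> fe x _ /connectP[p e_p ->]; elim: p x e_p => [|y p IHp] x //=.
by case/andP=> /fe exy /IHp; apply: connect_trans.
Qed.

(** Maps that are inverse only up to connectivity still induce inverse bijections on components.
    This weak form serves [ncomp_eliminate], where the two graphs differ by a vertex. *)
Lemma n_comp_equiv (T T' : finType) (e : rel T) (e' : rel T')
    (f : T' -> T) (g : T -> T') :
    ssrbool.symmetric e -> ssrbool.symmetric e' ->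
    (forall x y, e' x y -> connect e (f x) (f y)) ->
    (forall x y, e x y -> connect e' (g x) (g y)) ->
    (forall x, connect e x (f (g x))) -> (forall x, connect e' x (g (f x))) ->
  n_comp e T = n_comp e' T'.
Proof.
move=> /sym_connect_sym sym_e /sym_connect_sym sym_e' fe ge fgK gfK.
apply: (@adjunction_n_comp _ _ f) => //.
split=> [x _|x y _]; first by exists (g x).
apply/idP/idP => [|exy]; first exact: connect_homo.
apply: connect_trans (gfK x) _; rewrite sym_e'.
by apply: connect_trans (gfK y) _; rewrite sym_e'; apply: connect_homo exy.
Qed.

Lemma sinducedE (H : sgraph) (X : {set H}) (u v : sinduced X) :
  sadj u v = sadj (val u) (val v).
Proof. by []. Qed.

Lemma ncomp_imset (H' H : sgraph) (h : H' -> H) (Y : {set H'}) :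
    {in Y &, injective h} ->
    {in Y &, forall u v, sadj (h u) (h v) = sadj u v} ->
  ncomp (sinduced (h @: Y)) = ncomp (sinduced Y).
Proof.
move=> h_inj h_adj.
pose f (v : sinduced Y) : sinduced (h @: Y) := Sub (h (val v)) (imset_f h (valP v)).
have f_inj : injective f.
  by move=> u v [/(h_inj _ _ (valP u) (valP v))]; apply: val_inj.
have [|g fK gK] := inj_card_bij f_inj; first by rewrite !card_sig card_in_imset.
apply: (@n_comp_equiv _ _ _ _ f g) => [||u v uv|u v uv|u|u];
  rewrite ?fK ?gK ?connect0 //; try exact: sadj_sym.
  by apply: connect1; rewrite sinducedE /= h_adj; first exact: uv; apply: valP.
apply: connect1; move: uv; rewrite -{1}(gK u) -{1}(gK v) sinducedE /=.
by rewrite h_adj; [exact | apply: valP | apply: valP].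
Qed.

(* [H'] is [H] with [e] deleted and its neighbours joined pairwise, which is
   the effect on the line graph of contracting [e]. *)
Lemma ncomp_eliminate (H' H : sgraph) (h : H' -> H) (e : H) (Y : {set H'}) f0 :
    injective h ->
    (forall u, h u != e) ->
    (forall u v, sadj u v =
       (u != v) && (sadj (h u) (h v) || sadj e (h u) && sadj e (h v))) ->
    f0 \in Y -> sadj e (h f0) ->
  ncomp (sinduced (e |: h @: Y)) = ncomp (sinduced Y).
Proof.
move=> h_inj h_e h_adj f0Y e_f0.
have fP (v : sinduced Y) : h (val v) \in e |: h @: Y.
  by apply: setU1r; apply: imset_f; apply: valP.
pose f (v : sinduced Y) : sinduced (e |: h @: Y) := Sub (h (val v)) (fP v).
pose v0 : sinduced Y := Sub f0 f0Y.
pose e0 : sinduced (e |: h @: Y) := Sub e (setU11 _ _).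
(* [g] inverts [f] on its image. The one vertex left is [e0]; it gets the default [v0], whose image
   is a neighbour of [e0]. *)
pose g x := odflt v0 [pick v | f v == x].
have f_inj : injective f.
  by move=> u v [/h_inj]; apply: val_inj.
have fK v : g (f v) = v.
  rewrite /g; case: pickP => [u /eqP/f_inj //|/(_ v)]; by rewrite eqxx.
have ge0 : g e0 = v0.
  rewrite /g; case: pickP => // u /eqP/(congr1 val)/= /eqP.
  by rewrite (negbTE (h_e _)).
have xP x : x = e0 \/ exists v, x = f v.
  case: (setU1P (valP x)) => [xe|/imsetP[v vY xv]]; first by left; apply: val_inj.
  by right; exists (Sub v vY); apply: val_inj.
apply: (@n_comp_equiv _ _ _ _ f g) => [||u v|x y|x|v]; rewrite ?fK ?connect0 //;
  try exact: sadj_sym.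
- rewrite sinducedE h_adj => /andP[_ /orP[uv|/andP[eu ev]]].
    exact: connect1.
  (* An edge created between two neighbours of [e] becomes a path through [e]. *)
  apply: (@connect_trans _ _ e0); apply: connect1; rewrite sinducedE //=.
  by rewrite sadj_sym.
- have [->|[u ->]] := xP x; have [->|[v ->]] := xP y; rewrite ?ge0 ?fK ?connect0 //.
  (* [v] and [v0] both come from neighbours of [e], so they are equal or joined in [H']. *)
  + move=> ev0; have {ev0}ev : sadj e (h (val v)) := ev0.
    have [<-|ne] := eqVneq v0 v; first exact: connect0.
    apply: connect1; rewrite sinducedE h_adj /= ev e_f0 orbT andbT.
    by rewrite -val_eqE in ne.
  + rewrite sadj_sym => eu0; have {eu0}eu : sadj e (h (val u)) := eu0.
    have [<-|ne] := eqVneq u v0; first exact: connect0.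
    apply: connect1; rewrite sinducedE h_adj /= eu e_f0 orbT andbT.
    by rewrite -val_eqE in ne.
  + move=> uv0; have {uv0}uv : sadj (h (val u)) (h (val v)) := uv0.
    have [<-|ne] := eqVneq u v; first exact: connect0.
    apply: connect1; rewrite sinducedE h_adj /= uv andbT.
    by rewrite -val_eqE in ne.
have [->|[u ->]] := xP x; last by rewrite fK connect0.
by rewrite ge0 connect1.
Qed.

(** With no edge between them, [X] and [Y] are complementary closed sets of the induced graph, so
    its components split. *)
Lemma ncomp_setU (H : sgraph) (X Y : {set H}) :
    [disjoint X & Y] ->
    (forall u v, u \in X -> v \in Y -> ~~ sadj u v) ->
  ncomp (sinduced (X :|: Y)) = (ncomp (sinduced X) + ncomp (sinduced Y))%N.
Proof.
move=> dXY adjXY.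
have symP (K : sgraph) : connect_sym (@sadj K).
  exact/sym_connect_sym/sadj_sym.
(* Stated for a general pair so that it applies to [X], [Y] in either order. *)
have part (A B : {set H}) : A :|: B = X :|: Y ->
    [disjoint A & B] ->
    (forall u v, u \in A -> v \in B -> ~~ sadj u v) ->
    n_comp (@sadj (sinduced (X :|: Y))) [pred w | val w \in A] = ncomp (sinduced A).
  move=> AB dAB adjAB.
  have hP (w : sinduced A) : val w \in X :|: Y by rewrite -AB; apply/setUP; left; apply: valP.
  pose h (w : sinduced A) : sinduced (X :|: Y) := Sub (val w) (hP w).
  have clA : closed (@sadj (sinduced (X :|: Y))) [pred w | val w \in A].
    apply: intro_closed => [|u v].
      by apply: sym_connect_sym; apply: sadj_sym.
    rewrite !inE sinducedE => uv uA.
    have /setUP[//|vB] : val v \in A :|: B by rewrite AB; apply: valP.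
    move: (adjAB _ _ uA vB); by rewrite uv.
  rewrite (@adjunction_n_comp _ _ h _ (@sadj (sinduced A))) //; try exact: symP.
    by apply: eq_n_comp_r => w; rewrite !inE; apply: (valP w).
  apply: strict_adjunction => //.
  - by move=> u v /(congr1 val) /= /val_inj.
  - apply/subsetP=> w wA; apply/codomP; exists (Sub (val w) wA); exact: val_inj.
rewrite /ncomp (n_compC [pred w | val w \in X]) (part X Y) //; congr addn.
rewrite -/(ncomp (sinduced Y)) -(part Y X); first last.
- by move=> u v uY vX; rewrite sadj_sym adjXY.
- by rewrite disjoint_sym.
- by rewrite setUC.
apply: eq_n_comp_r => w; rewrite !inE /=.
case/setUP: (valP w) => wXY; last by rewrite wXY (disjointFl dXY).
by rewrite wXY (disjointFr dXY).
Qed.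

Lemma ncomp_set1 (H : sgraph) (e : H) : ncomp (sinduced [set e]) = 1%N.
Proof.
pose e0 : sinduced [set e] := Sub e (set11 e).
have <- := n_comp_connect (sym_connect_sym (@sadj_sym (sinduced [set e]))) e0.
apply: eq_n_comp_r => w; rewrite !inE; symmetry; apply: eq_connect0.
by apply: val_inj; rewrite /= (set1P (valP w)).
Qed.

Lemma ncomp_set0 (H : sgraph) : ncomp (sinduced (@set0 H)) = 0%N.
Proof. by apply: eq_card0 => w; have := valP w; rewrite inE. Qed.

Lemma ncomp_le_card (H : sgraph) (X : {set H}) : (ncomp (sinduced X) <= #|X|)%N.
Proof.
rewrite -(card_sig [in X]); apply: leq_trans (max_card _).
exact: eq_leq.
Qed.

(** * The closed sum over edge sets *)

Definition uncovered (G : mgraph) (X : {set edge G}) : {set vert G} :=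
  [set v | [forall f in X, v \notin ends f]].

Lemma uncoveredP (G : mgraph) (X : {set edge G}) v :
  reflect (forall f, f \in X -> v \notin ends f) (v \in uncovered X).
Proof. by rewrite inE; apply: (iffP forall_inP). Qed.

Definition ecomp (G : mgraph) (X : {set edge G}) : nat :=
  ncomp (@sinduced (line_graph G) X).

(** Here [a], [m], [c] stand for i(X), |X|, c(X). For these values [ecomp_le_card] makes the
    subtraction exact. *)
Definition xi_monom (a m c : nat) : {mpoly int[3]} :=
  'X_0 ^+ a * 'X_1 ^+ (m - c) * ('X_0 * 'X_1 + 'X_2) ^+ c.

Lemma xi_monomS a m c :
  (c <= m)%N -> xi_monom a m.+1 c = 'X_1 * xi_monom a m c.
Proof. by move=> le_cm; rewrite /xi_monom subSn // exprS mulrCA !mulrA. Qed.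

(** Expands one factor ['X_0 * 'X_1 + 'X_2], the contribution of an edge isolated from the others;
    its ['X_0] is absorbed in [a.+1], the contracted vertex being uncovered. *)
Lemma xi_monomSS a m c :
  xi_monom a m.+1 c.+1 = 'X_1 * xi_monom a.+1 m c + 'X_2 * xi_monom a m c.
Proof.
rewrite /xi_monom subSS !exprS mulrCA mulrDl; congr (_ + _).
by rewrite -!mulrA mulrCA.
Qed.

Lemma xi_monomD a1 a2 m1 m2 c1 c2 : (c1 <= m1)%N -> (c2 <= m2)%N ->
  xi_monom (a1 + a2) (m1 + m2) (c1 + c2) = xi_monom a1 m1 c1 * xi_monom a2 m2 c2.
Proof.
move=> le1 le2; rewrite /xi_monom subnDA -addnBAC // -addnBA // !exprD.
by rewrite (mulrACA ('X_0 ^+ a1)) [LHS]mulrACA.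
Qed.

Definition xi_sum (G : mgraph) : {mpoly int[3]} :=
  \sum_(X : {set edge G}) xi_monom #|uncovered X| #|X| (ecomp X).

Lemma ecomp_le_card (G : mgraph) (X : {set edge G}) : (ecomp X <= #|X|)%N.
Proof. exact: (@ncomp_le_card (line_graph G)). Qed.

(** Line graph adjacency depends only on equality and disjointness of edges, so vertices may change
    freely as long as these are preserved. *)
Lemma ecomp_imset (G' G : mgraph) (h : edge G' -> edge G) (Y : {set edge G'}) :
    injective h ->
    {in Y &, forall f g, [disjoint ends (h f) & ends (h g)] = [disjoint ends f & ends g]} ->
  ecomp (h @: Y) = ecomp Y.
Proof.
move=> h_inj h_ends; apply: (@ncomp_imset (line_graph G') (line_graph G)) => /=.
  by move=> f g _ _; apply: h_inj.
by move=> f g fY gY; rewrite /= /line_adj h_ends // (inj_eq h_inj).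
Qed.

(** Image and preimage under [val] are inverse here. The edges of [delete], [contract] and [extract]
    form such subtypes. *)
Lemma big_subset_sub (T : finType) (P : pred T) (V : nmodType) (F : {set T} -> V) :
  \sum_(X : {set T} | X \subset P) F X = \sum_(Y : {set {x | P x}}) F (val @: Y).
Proof.
rewrite (reindex_onto (fun Y : {set {x | P x}} => val @: Y)
  (fun X => val @^-1: X)) /=.
  apply: eq_bigl => Y; apply/andP; split.
    by apply/subsetP=> _ /imsetP[x _ ->]; apply: valP.
  apply/eqP/setP=> x; rewrite inE mem_imset //; exact: val_inj.
move=> X /subsetP XP; apply/setP=> x; apply/imsetP/idP => [[y + ->]|xX].
  by rewrite inE.
by exists (Sub x (XP x xX)); rewrite ?inE.
Qed.

Lemma big_set_edge (T : finType) (e : T) (V : nmodType) (F : {set T} -> V) :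
  \sum_(X : {set T}) F X = \sum_(Y : {set {x | x != e}}) F (val @: Y)
                         + \sum_(Y : {set {x | x != e}}) F (e |: val @: Y).
Proof.
have subE (X : {set T}) : (X \subset [pred x | x != e]) = (e \notin X).
  apply/subsetP/idP => [sub|eX x xX]; first by apply/negP=> /sub; rewrite inE eqxx.
  by rewrite inE; apply: contraNneq eX => <-.
rewrite (bigID (fun X : {set T} => e \notin X)) /=; congr (_ + _).
  by rewrite -(@big_subset_sub _ [pred x | x != e]); apply: eq_bigl => X.
rewrite -(@big_subset_sub _ [pred x | x != e] _ (fun X => F (e |: X))).
rewrite (reindex_onto (fun X => e |: X) (fun X => X :\ e)) /=; last first.
  by move=> X; rewrite negbK => eX; rewrite setD1K.
apply: eq_bigl => X; rewrite subE setU11 /=.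
by apply/eqP/idP => [<-|/setU1K //]; rewrite !inE eqxx.
Qed.

Lemma xi_sum_iso (G H : mgraph) : miso G H -> xi_sum G = xi_sum H.
Proof.
case=> phi [psi [phi_bij psi_bij ends_psi]].
have [phi_inj psi_inj] := (bij_inj phi_bij, bij_inj psi_bij).
rewrite /xi_sum [RHS](reindex (fun X : {set edge G} => psi @: X)) /=; last first.
  case: psi_bij => psi' psiK psiK'.
  by exists (fun X : {set edge H} => psi' @: X) => X _;
    rewrite -imset_comp (eq_imset _ (g := id)) ?imset_id.
apply: eq_bigr => X _; congr xi_monom.
- rewrite -(card_imset _ phi_inj); apply: eq_card => w.
  have [phi' phiK phiK'] := phi_bij; rewrite -(phiK' w) mem_imset //.
  apply/uncoveredP/uncoveredP => [wX _ /imsetP[f fX ->]|wX f fX].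
    by rewrite ends_psi mem_imset ?wX.
  by have := wX _ (imset_f psi fX); rewrite ends_psi mem_imset.
- by rewrite card_imset.
- apply/esym/ecomp_imset => // f g _ _.
  by rewrite !ends_psi -!setI_eq0 -imsetI ?imset_eq0 // => u v _ _; apply: phi_inj.
Qed.

(** * The recurrence at an edge *)

Section EdgeRecurrence.
Variables (G : mgraph) (e : edge G).

Lemma xi_sum_delete :
  xi_sum (delete e) = \sum_(Y : {set edge (delete e)})
    xi_monom #|uncovered (G := G) (val @: Y)| #|Y| (ecomp (G := G) (val @: Y)).
Proof.
apply: eq_bigr => Y _; congr xi_monom.
  apply: eq_card => v; apply/uncoveredP/uncoveredP => [vY _ /imsetP[f fY ->]|vY f fY].
    exact: vY.
  exact/vY/imset_f.
by apply/esym; apply: (@ecomp_imset (delete e) G) => //; exact: val_inj.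
Qed.

Lemma mem_None_contract_ends (f : edge (contract e)) :
  (None \in contract_ends f) = ~~ [disjoint ends e & ends (val f)].
Proof.
apply/imsetP/pred0Pn => [[v vf]|[v /andP[ve vf]]].
  rewrite /contract_map; case: insubP => // ve _.
  by exists v; rewrite /= vf andbT (negbNE ve).
by exists v => //; rewrite /contract_map insubF //; apply/negbTE/negPn.
Qed.

Lemma mem_Some_contract_ends (f : edge (contract e)) (v : {v | v \notin ends e}) :
  (Some v \in contract_ends f) = (val v \in ends (val f)).
Proof.
apply/imsetP/idP => [[w wf]|vf]; last by exists (val v); rewrite // /contract_map valK.
by rewrite /contract_map; case: insubP => // u _ uw [->]; rewrite uw.
Qed.

(** After contraction two edges meet at the image of a common vertex or, when both touch [e], at the
    merged vertex. This is the adjacency rule of [ncomp_eliminate]. *)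
Lemma disjoint_contract_ends (f g : edge (contract e)) :
  ~~ [disjoint contract_ends f & contract_ends g] =
     ~~ [disjoint ends (val f) & ends (val g)]
  || ~~ [disjoint ends e & ends (val f)] && ~~ [disjoint ends e & ends (val g)].
Proof.
rewrite -!mem_None_contract_ends.
apply/pred0Pn/orP => [[[v|] /andP[/= vf vg]]|[/pred0Pn[v /andP[/= vf vg]]|fg]].
- left; apply/pred0Pn; exists (val v).
  by rewrite /= -!mem_Some_contract_ends vf.
- by right; rewrite vf.
- by exists (contract_map e v); rewrite /= !imset_f.
- by exists None.
Qed.

(** The inclusion form matches the condition defining the edges of [extract e], as [big_subset_sub]
    requires. *)
Definition untouched (Y : {set {f : edge G | f != e}}) : bool :=
  val @: Y \subset [pred f | ends f \subset ~: ends e].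

Lemma untouchedP (Y : {set {f : edge G | f != e}}) :
  reflect {in Y, forall f, [disjoint ends e & ends (val f)]} (untouched Y).
Proof.
apply: (iffP subsetP) => [Ye f fY|Ye _ /imsetP[f fY ->]].
  by have := Ye _ (imset_f val fY); rewrite inE disjoint_sym disjoints_subset.
by rewrite inE -disjoints_subset disjoint_sym Ye.
Qed.

Lemma uncoveredU1 (X : {set edge G}) : uncovered (e |: X) = uncovered X :\: ends e.
Proof.
apply/setP=> v; rewrite in_setD; apply/uncoveredP/andP => [vX|[ve /uncoveredP vX] f].
  by split; [apply: vX; rewrite setU11|apply/uncoveredP=> f fX; apply/vX/setU1r].
by case/setU1P=> [->|/vX].
Qed.

(** The merged vertex [None] is uncovered exactly when [Y] is untouched, which gives the boolean
    summand; a vertex off [e] has the same status for [Y] and for [Y] with [e] added. *)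
Lemma card_uncovered_contract (Y : {set edge (contract e)}) :
  #|uncovered Y| = (untouched Y + #|uncovered (e |: val @: Y)|)%N.
Proof.
pose S := [set v : {v | v \notin ends e} | val v \in uncovered (val @: Y)].
have -> : #|uncovered (e |: val @: Y)| = #|Some @: S|.
  rewrite card_imset; last by move=> ? ? [].
  rewrite -(card_imset _ val_inj) uncoveredU1; apply: eq_card => v.
  rewrite in_setD; apply/andP/imsetP => [[ve vX]|[w + ->]].
    by exists (Sub v ve) => //; rewrite in_set.
  by rewrite in_set => wX; rewrite (valP w).
have SomeE (v : {v | v \notin ends e}) : (Some v \in uncovered Y) = (v \in S).
  rewrite [RHS]in_set; apply/uncoveredP/uncoveredP => [vY _ /imsetP[f fY ->]|vY f fY].
    by rewrite -mem_Some_contract_ends; apply: vY.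
  by rewrite mem_Some_contract_ends; apply/vY/imset_f.
have NoneE : (None \in uncovered Y) = untouched Y.
  apply/uncoveredP/untouchedP => YN f fY.
    by rewrite -[[disjoint _ & _]]negbK -mem_None_contract_ends; apply: YN.
  by rewrite [_ \in _]mem_None_contract_ends negbK YN.
rewrite (cardD1 (None : vert (contract e))) NoneE; congr addn; apply: eq_card => -[v|]; rewrite inE /=.
  by rewrite SomeE mem_imset // => ? ? [].
by apply/esym/imsetP => -[].
Qed.

(** An edge of [Y] touching [e] is the neighbour [f0] that [ncomp_eliminate] asks for. *)
Lemma ecomp_contract (Y : {set edge (contract e)}) :
  ~~ untouched Y -> ecomp Y = ecomp (e |: val @: Y).
Proof.
case/subsetPn=> _ /imsetP[f fY ->]; rewrite inE -disjoints_subset disjoint_sym => ef.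
apply/esym.
apply: (@ncomp_eliminate (line_graph (contract e)) (line_graph G) val e Y f) => //=.
- exact: val_inj.
- by move=> u; exact: (valP u).
- move=> u v; rewrite /line_adj /= disjoint_contract_ends -val_eqE /=.
  rewrite !(eq_sym e) !(valP u, valP v) /=.
  by case: (_ != _).
- by rewrite /line_adj eq_sym (valP f).
Qed.

Lemma ecomp_contract_untouched (Y : {set edge (contract e)}) :
  untouched Y -> ecomp Y = ecomp (G := G) (val @: Y).
Proof.
move/untouchedP=> Ye; apply/esym.
apply: (@ecomp_imset (contract e) G); first exact: val_inj.
move=> f g fY gY; apply: negb_inj.
by rewrite [in RHS]disjoint_contract_ends (Ye f) // orbF.
Qed.

Lemma ecompU1_untouched (Y : {set edge (contract e)}) :
  untouched Y -> ecomp (e |: val @: Y) = (ecomp (G := G) (val @: Y)).+1.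
Proof.
move/untouchedP=> Ye; rewrite /ecomp (@ncomp_setU (line_graph G)) ?ncomp_set1 //.
  by rewrite disjoints1; apply/imsetP=> -[f _ ef]; have := valP f; rewrite -ef eqxx.
by move=> _ _ /set1P-> /imsetP[f fY ->]; rewrite /= /line_adj (Ye f fY) andbF.
Qed.

Lemma ends_neq0 (f : edge G) : ends f != set0.
Proof. by rewrite -card_gt0; case/andP: (card_ends f). Qed.

(** Moves the sum to the index type shared by deletion and contraction. Adding [e] to the set
    discards the endpoints of [e], which are absent from [extract e]. *)
Lemma xi_sum_extract :
  xi_sum (extract e) = \sum_(Y : {set {f : edge G | f != e}} | untouched Y)
    xi_monom #|uncovered (e |: val @: Y)| #|Y| (ecomp (G := G) (val @: Y)).
Proof.
pose K (X : {set edge G}) := xi_monom #|uncovered (e |: X)| #|X| (ecomp X).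
transitivity (\sum_(Y : {set {f : edge G | f != e}} | untouched Y) K (val @: Y));
  last by apply: eq_bigr => Y _; rewrite /K card_imset //; apply: val_inj.
rewrite big_mkcond /= -(@big_subset_sub _ [pred f | f != e] _ (fun X =>
  if X \subset [pred f | ends f \subset ~: ends e] then K X else 0)) -big_mkcondr /=.
rewrite (eq_bigl (fun X : {set edge G} =>
  X \subset [pred f | ends f \subset ~: ends e])) => [|X]; last first.
  (* An edge avoiding the nonempty set [ends e] cannot be [e], so the condition [f != e] is
     absorbed. *)
  apply: andb_idl => /subset_trans; apply; apply/subsetP=> f; rewrite !inE.
  apply: contraTneq => ->; rewrite -disjoints_subset -setI_eq0 setIid; exact: ends_neq0.
rewrite big_subset_sub; apply: eq_bigr => Z _; rewrite /K; congr xi_monom.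
- rewrite -(card_imset _ val_inj) uncoveredU1; apply: eq_card => v.
  rewrite in_setD; apply/imsetP/andP => [[w /uncoveredP wZ ->]|[ve /uncoveredP vZ]].
    split; first by have := valP w; rewrite inE.
    apply/uncoveredP=> _ /imsetP[f fZ ->]; have := wZ f fZ; by rewrite inE.
  have vP : v \in ~: ends e by rewrite inE.
  exists (Sub v vP) => //; apply/uncoveredP=> f fZ; rewrite inE /=.
  exact/vZ/imset_f.
- by rewrite card_imset //; apply: val_inj.
apply/esym; apply: (@ecomp_imset (extract e) G); first exact: val_inj.
move=> f g _ _; apply: negb_inj; apply/pred0Pn/pred0Pn => [[v /andP[/= vf vg]]|].
  by exists (Sub v (subsetP (valP f) v vf)); rewrite /= !inE /= vf.
by case=> v /andP[]; rewrite !inE => vf vg; exists (val v); rewrite /= vf.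
Qed.

Lemma xi_sum_edge :
  xi_sum G = xi_sum (delete e) + 'X_1 * xi_sum (contract e) + 'X_2 * xi_sum (extract e).
Proof.
have cardY (Y : {set {f : edge G | f != e}}) : #|val @: Y| = #|Y|.
  by rewrite card_imset //; apply: val_inj.
have cardU1 (Y : {set {f : edge G | f != e}}) : #|e |: val @: Y| = #|Y|.+1.
  rewrite cardsU1 cardY; suff -> : e \notin [set val f | f in Y] by [].
  by apply/imsetP=> -[f _ ef]; have := valP f; rewrite -ef eqxx.
rewrite {1}/xi_sum (big_set_edge e) -addrA; congr (_ + _).
  by rewrite xi_sum_delete; apply: eq_bigr => Y _; rewrite cardY.
(* The extraction sum is extended by zero to all [Y], then merged termwise with the contraction
   sum. *)
rewrite xi_sum_extract /xi_sum !big_distrr /= [X in _ + X]big_mkcond -big_split /=.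
apply: eq_bigr => Y _; rewrite cardU1 card_uncovered_contract.
have leY : (ecomp (G := contract e) Y <= #|Y|)%N by apply: ecomp_le_card.
case: ifPn => Ye.
  rewrite ecompU1_untouched // ecomp_contract_untouched //.
  exact: xi_monomSS.
by rewrite -ecomp_contract // addr0 xi_monomS.
Qed.

End EdgeRecurrence.

(** * Disjoint unions and edgeless graphs *)

Lemma xi_sum_union (G1 G2 : mgraph) : xi_sum (munion G1 G2) = xi_sum G1 * xi_sum G2.
Proof.
rewrite /xi_sum big_distrlr /= pair_big /=.
pose h (p : {set edge G1} * {set edge G2}) : {set edge (munion G1 G2)} :=
  inl @: p.1 :|: inr @: p.2.
pose h' (X : {set edge (munion G1 G2)}) := (inl @^-1: X, inr @^-1: X).
have in_inl Y p : (inl p \in h Y) = (p \in Y.1).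
  rewrite inE mem_imset; last by move=> ? ? [].
  by rewrite orbC; case: imsetP => // -[].
have in_inr Y p : (inr p \in h Y) = (p \in Y.2).
  rewrite inE orbC mem_imset; last by move=> ? ? [].
  by rewrite orbC; case: imsetP => // -[].
rewrite (reindex h); last first.
  exists h' => [[Y1 Y2] _|X _].
    by congr (_, _); apply/setP=> f; rewrite inE ?in_inl ?in_inr.
  by apply/setP=> -[] f; rewrite ?in_inl ?in_inr inE.
apply: eq_bigr => -[Y1 Y2] _ /=.
have disjLR (T1 T2 : finType) (A : {set T1}) (B : {set T2}) :
    [disjoint @inl T1 T2 @: A & @inr T1 T2 @: B].
  by apply/pred0P=> x; apply/negbTE/negP=> /andP[/imsetP[y _ ->] /imsetP[]].
have cardLR (T1 T2 : finType) (A : {set T1}) (B : {set T2}) :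
    #|@inl T1 T2 @: A :|: @inr T1 T2 @: B| = (#|A| + #|B|)%N.
  rewrite -(card_imset A (inl_inj (A := T1) (B := T2))).
  rewrite -(card_imset B (inr_inj (A := T1) (B := T2))).
  by apply/eqP; rewrite (leq_card_setU _ _).2 disjLR.
rewrite -xi_monomD ?ecomp_le_card //; congr xi_monom.
- rewrite -cardLR; apply: eq_card => v; rewrite [RHS]inE.
  have unc1 u : (inl u \in uncovered (h (Y1, Y2))) = (u \in uncovered Y1).
    apply/uncoveredP/uncoveredP => [uh f fY|uY [] f].
    - by have := uh (inl f); rewrite in_inl /= mem_imset; [apply|apply: inl_inj].
    - by rewrite in_inl /= mem_imset; [apply: uY|apply: inl_inj].
    - by move=> _; apply/imsetP=> -[].
  have unc2 u : (inr u \in uncovered (h (Y1, Y2))) = (u \in uncovered Y2).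
    apply/uncoveredP/uncoveredP => [uh f fY|uY [] f].
    - by have := uh (inr f); rewrite in_inr /= mem_imset; [apply|apply: inr_inj].
    - by move=> _; apply/imsetP=> -[].
    - by rewrite in_inr /= mem_imset; [apply: uY|apply: inr_inj].
  case: v => v.
    rewrite unc1 mem_imset; last exact: inl_inj.
    by rewrite orbC; case: imsetP => // -[].
  rewrite unc2 orbC mem_imset; last exact: inr_inj.
  by rewrite orbC; case: imsetP => // -[].
- exact: cardLR.
(* Left and right edges share no vertex, so the line graph has no edge between the two parts. *)
rewrite /ecomp /h (@ncomp_setU (line_graph (munion G1 G2))) /=; first last.
- move=> _ _ /imsetP[f _ ->] /imsetP[g _ ->]; rewrite /line_adj /=.
  by rewrite disjLR.
- exact: disjLR.
congr (_ + _)%N.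
  apply: (@ecomp_imset G1 (munion G1 G2)) => [|f g _ _]; first exact: inl_inj.
  by rewrite -!setI_eq0 /= -imsetI ?imset_eq0 // => u v _ _; apply: inl_inj.
apply: (@ecomp_imset G2 (munion G1 G2)) => [|f g _ _]; first exact: inr_inj.
by rewrite -!setI_eq0 /= -imsetI ?imset_eq0 // => u v _ _; apply: inr_inj.
Qed.

Lemma xi_sum_edgeless (T : finType) : xi_sum (edgeless T) = 'X_0 ^+ #|T|.
Proof.
rewrite /xi_sum (big_pred1 set0) => [|X]; last first.
  by apply/esym/eqP/setP=> -[].
rewrite /xi_monom cards0 [ecomp _](ncomp_set0 (line_graph (edgeless T))) !mulr1.
congr (_ ^+ _); rewrite -cardsT; apply: eq_card => v.
by rewrite [RHS]inE; apply/uncoveredP=> -[].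
Qed.

Lemma xi_sum_is_xi : is_xi xi_sum.
Proof.
split.
- exact: xi_sum_iso.
- exact: xi_sum_edge.
- exact: xi_sum_union.
- by rewrite xi_sum_edgeless card_unit.
- by rewrite xi_sum_edgeless card_void.
Qed.

(** * Uniqueness of the solution *)

Lemma miso_edgeless (G : mgraph) (T : finType) :
  #|edge G| = 0%N -> #|vert G| = #|T| -> miso G (edgeless T).
Proof.
move=> noE eqGT; have noe (e : edge G) : void.
  by have := card0_eq noE e; rewrite !inE.
exists (fun v => enum_val (cast_ord eqGT (enum_rank v))), noe; split.
- exists (fun x => enum_val (cast_ord (esym eqGT) (enum_rank x))) => x.
    by rewrite enum_valK cast_ordK enum_rankK.
  by rewrite enum_valK cast_ordKV enum_rankK.
- by exists (of_void _) => [e|[]]; case: (noe e).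
- by move=> e; case: (noe e).
Qed.

Lemma is_xi_edgeless (F : mgraph -> {mpoly int[3]}) :
  is_xi F -> forall G, #|edge G| = 0%N -> F G = 'X_0 ^+ #|vert G|.
Proof.
move=> Fxi G noE; move cardG: #|vert G| => n.
elim: n G noE cardG => [|n IHn] G noE cardG.
  by rewrite (xi_iso Fxi (@miso_edgeless G void _ _)) ?card_void // (xi_null Fxi).
(* One vertex is split off. The edge type of [H] is [void + void], so [G] and [H] are both compared
   with [edgeless (vert H)]. *)
pose H := munion (edgeless unit) (edgeless 'I_n).
rewrite (@xi_iso _ Fxi G (edgeless (vert H))); last first.
  by apply: miso_edgeless => //; rewrite card_sum card_unit card_ord.
rewrite -(@xi_iso _ Fxi H (edgeless (vert H))); last first.
  by apply: miso_edgeless => //; rewrite card_sum card_void.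
rewrite (xi_union Fxi) (xi_vertex Fxi) IHn ?card_void ?card_ord //.
by rewrite exprS.
Qed.

Lemma is_xi_unique (F1 F2 : mgraph -> {mpoly int[3]}) :
  is_xi F1 -> is_xi F2 -> F1 =1 F2.
Proof.
move=> xi1 xi2 G; have [n] := ubnP #|edge G|.
elim: n G => // n IHn G; rewrite ltnS => le_n.
have [noE|gt0] := posnP #|edge G|; first by rewrite !is_xi_edgeless.
have /card_gt0P[e _] := gt0; rewrite (xi_edge xi1 e) (xi_edge xi2 e).
(* This type serves both [delete e] and [contract e]; the edges of [extract e] are also distinct
   from [e], so they are no more numerous. *)
have lt_del : (#|{: {f : edge G | f != e}}| < n)%N.
  by rewrite card_sig (eq_card (B := predC1 e)) // cardC1 prednK.
rewrite !IHn // (leq_trans _ lt_del) // ltnS !card_sig.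
apply/subset_leq_card/subsetP=> f; rewrite !inE.
apply: contraTneq => ->; rewrite -disjoints_subset -setI_eq0 setIid; exact: ends_neq0.
Qed.

Theorem theorem5p11 (G : mgraph) :
  xi G \mPo [tuple 1; 'X_0; 'X_0 * ('X_1 - 1)] = Qpoly (line_graph G).
Proof.
(* [xi_sum] witnesses existence, so the choice operator returns a solution rather than its
   default. *)
have xiP : is_xi xi by apply: epsilon_spec; exists xi_sum; apply: xi_sum_is_xi.
rewrite (is_xi_unique xiP xi_sum_is_xi) /xi_sum /Qpoly raddf_sum /=.
apply: eq_bigr => X _; rewrite /xi_monom !rmorphM !rmorphXn rmorphD rmorphM /=.
(* The factor becomes x + (x y - x) = x y; its powers of x then restore the exponent |X| from |X| -
   c(X). *)
rewrite !comp_mpolyXU /= expr1n !mul1r mulrBr mulr1 [_ + (_ - _)]addrC subrK.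
by rewrite exprMn mulrA -exprD subnK ?ecomp_le_card.
Qed.
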